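(* Let $E$ be a Banach lattice. The following are equivalent: (1) $E$ is uniformly monotone. (2) $E^{(p)}$ is uniformly convex for all $1<p<\infty$. (3) $E^{(p)}$ is uniformly convex for some $1<p<\infty$.
   Context: For a Banach lattice $E$ and $1<p<\infty$, the $p$-convexification $E^{(p)}$ is the vector lattice with the same underlying set and order as $E$ but with new operations $x\oplus y=(x^{1/p}+y^{1/p})^p$ and $\alpha\odot x=\alpha^p x$ (where for real $t$, $t^{s}$ means $\mathrm{sign}(t)|t|^{s}$, defined via the Krivine functional calculus), normed by $\|x\|_{E^{(p)}}=\|x\|_E^{1/p}$; it is a Banach lattice. For $1\le q<\infty$ and $\epsilon>0$ put $M_q(\epsilon)=\inf\{\|(|x|^q+|y|^q)^{1/q}\|-1:\|y\|\ge\epsilon,\ \|x\|=1\}$. $E$ is uniformly monotone if for some $1\le q<\infty$, $M_q(\epsilon)>0$ for every $\epsilon>0$. A Banach space $X$ is uniformly convex if for every $\epsilon>0$ there is $\delta>0$ with $\inf\{\max\{\|x+y\|,\|x-y\|\}:\|y\|\ge\epsilon,\|x\|=1\}\ge1+\delta$. *)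

(* Defs.v *)
From HB Require Import structures.
From mathcomp Require Import all_boot all_order all_algebra.
From mathcomp Require Import all_classical all_reals all_analysis.
Set Implicit Arguments. Unset Strict Implicit. Unset Printing Implicit Defensive.
Import Order.TTheory GRing.Theory Num.Theory.
Import numFieldNormedType.Exports.
Local Open Scope classical_set_scope.
Local Open Scope ring_scope.

Record lattice_on (R : realType) (E : normedModType R) := LatticeOn {
  lle : E -> E -> Prop ;
  lsup : E -> E -> E }.

Definition labs (R : realType) (E : normedModType R) (L : lattice_on E) (x : E) : E :=
  lsup L x (- x).

Definition is_banach_lattice (R : realType) (E : completeNormedModType R)
    (L : lattice_on E) : Prop :=
  [/\ (forall x, lle L x x),
      (forall x y, lle L x y -> lle L y x -> x = y),
      (forall x y z, lle L x y -> lle L y z -> lle L x z),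
      (forall x y z, lle L x y -> lle L (x + z) (y + z))
    & [/\ (forall (a : R) x y, 0 <= a -> lle L x y -> lle L (a *: x) (a *: y)),
      (forall x y, [/\ lle L x (lsup L x y), lle L y (lsup L x y) &
                       (forall z, lle L x z -> lle L y z -> lle L (lsup L x y) z)])
    & (forall x y, lle L (labs L x) (labs L y) -> `|x| <= `|y|)]].

Definition H2 (R : realType) (F : R * R -> R) : Prop :=
  continuous F /\
  forall (a : R) (u : R * R), 0 <= a -> F (a * u.1, a * u.2) = a * F u.

(* Krivine functional calculus (Lindenstrauss-Tzafriri 1.d.1): z = F(x, y)
   iff there is a vector lattice homomorphism Phi : H_2 -> E sending the
   coordinate projections to x and y, and Phi F = z. *)
Definition krivine_rel (R : realType) (E : normedModType R) (L : lattice_on E)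
    (x y : E) (F : R * R -> R) (z : E) : Prop :=
  exists Phi : (R * R -> R) -> E,
    [/\ (forall G K, H2 G -> H2 K -> Phi (fun u => G u + K u) = Phi G + Phi K),
        (forall (a : R) G, H2 G -> Phi (fun u => a * G u) = a *: Phi G),
        (forall G K, H2 G -> H2 K ->
            Phi (fun u => Num.max (G u) (K u)) = lsup L (Phi G) (Phi K))
      & [/\ Phi fst = x, Phi snd = y & Phi F = z]].

(* The element F(x, y) of E (it exists and is unique in a Banach lattice). *)
Definition krivine (R : realType) (E : normedModType R) (L : lattice_on E)
    (F : R * R -> R) (x y : E) : E :=
  xget 0 [set z | krivine_rel L x y F z].

Definition spow (R : realType) (t s : R) : R := Num.sg t * (`|t| `^ s).

Definition conv_fun (R : realType) (p : R) (u : R * R) : R :=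
  spow (spow u.1 p^-1 + spow u.2 p^-1) p.

Definition lq_fun (R : realType) (q : R) (u : R * R) : R :=
  (`|u.1| `^ q + `|u.2| `^ q) `^ q^-1.

(* Operations and norm of the p-convexification E^(p). *)
Definition padd (R : realType) (E : normedModType R) (L : lattice_on E)
    (p : R) (x y : E) : E := krivine L (conv_fun p) x y.
Definition psmul (R : realType) (E : normedModType R) (p : R) (a : R) (x : E) : E :=
  spow a p *: x.
Definition pnorm (R : realType) (E : normedModType R) (p : R) (x : E) : R :=
  `|x| `^ p^-1.

(* M_q(eps) = inf {|| (|x|^q + |y|^q)^{1/q} || - 1 : ||y|| >= eps, ||x|| = 1 }
   (extended-real infimum; inf of the empty set is +oo). *)
Definition Mq (R : realType) (E : normedModType R) (L : lattice_on E)
    (q eps : R) : \bar R :=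
  ereal_inf [set r : \bar R | exists x y : E, [/\ `|y| >= eps, `|x| = 1 &
      r = (`|krivine L (lq_fun q) x y| - 1)%:E]].

Definition uniformly_monotone (R : realType) (E : normedModType R)
    (L : lattice_on E) : Prop :=
  exists q : R, 1 <= q /\ forall eps : R, 0 < eps -> (0 < Mq L q eps)%E.

Definition pconv_uniformly_convex (R : realType) (E : normedModType R)
    (L : lattice_on E) (p : R) : Prop :=
  forall eps : R, 0 < eps -> exists2 delta : R, 0 < delta &
    (((1 + delta)%R)%:E <= ereal_inf [set r : \bar R | exists x y : E,
       [/\ (pnorm p y >= eps)%R, pnorm p x = 1%R &
           r = (Num.max (pnorm p (padd L p x y))
                        (pnorm p (padd L p x (psmul p (-1) y))))%:E]])%E.

(* Main.v *)
Require Import Defs.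
From HB Require Import structures.
From mathcomp Require Import all_boot all_order all_algebra.
From mathcomp Require Import all_classical all_reals all_analysis.
From mathcomp Require Import ring lra.
Set Implicit Arguments. Unset Strict Implicit. Unset Printing Implicit Defensive.
Import Order.TTheory GRing.Theory Num.Theory.
Import numFieldNormedType.Exports.
Local Open Scope ring_scope.

(** In a Banach lattice every F in [H2] can be evaluated at (x, y): a maximum of
linear forms that is nonnegative on R^2 dominates a convex combination of its forms
equal to 0, so it is nonnegative when evaluated in E; hence evaluation is well defined
and monotone on differences of such maxima, and these are uniformly dense in [H2].

All inequalities then reduce to scalar ones through one compactness remark: if G in
[H2] is nonnegative and vanishes only where the second coordinate does, then for each
c > 0 there is C with |y| <= c|x| + C G(x, y), so G(x, y) has norm bounded below when
||x|| = 1 and ||y|| is bounded below.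

(1) => (2): write a, b for the p-th roots of x, y, so that x (+) y = (a + b)^p, and
take G = (|a + b|^p + |a - b|^p)/2 - |x|; it is nonnegative by strict convexity of
|t|^p, and (|x|^q + G^q)^(1/q) <= |x| + G has norm at most the larger of the norms of
(a + b)^p and (a - b)^p.

(3) => (1), with q = 1: put A = (|x| + |y|)^(1/p), a = |x|^(1/p), M = ((A + a)/2)^p and
D = ((A - a)/2)^p. Then M (+) D = |x| + |y| and M (-) D = |x|, while |x| <= M. If D has
large norm, uniform convexity forces || |x| + |y| || above 1; otherwise the compactness
remark for G = D does. *)

(** * Finite families of affine functions on a line *)

Lemma seq_separation (R : realFieldType) (s1 s2 : seq R) :
  (forall a b, a \in s1 -> b \in s2 -> a < b) ->
  exists t, (forall a, a \in s1 -> a < t) /\ (forall b, b \in s2 -> t < b).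
Proof.
have below : exists t, forall b, b \in s2 -> t < b.
  elim: s2 => [|b s [t ht]]; first by exists 0.
  exists (Num.min t (b - 1)) => c; rewrite inE => /orP[/eqP->|/ht].
    by rewrite gt_min ltrBlDr ltrDl ltr01 orbT.
  by move=> tc; rewrite gt_min tc.
have between a : (forall b, b \in s2 -> a < b) ->
    exists2 t, a < t & forall b, b \in s2 -> t < b.
  elim: {below} s2 => [|b s IH] h; first by exists (a + 1); rewrite ?ltrDl.
  have [|t a_t ht] := IH; first by move=> c cs; apply: h; rewrite inE cs orbT.
  have ab : a < b by apply: h; rewrite inE eqxx.
  exists (Num.min t ((a + b) / 2)); first by rewrite lt_min a_t midf_lt.
  move=> c; rewrite inE => /orP[/eqP->|/ht tc]; last by rewrite gt_min tc.
  by rewrite gt_min midf_lt ?orbT.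
elim: s1 => [|a s IH] h; first by have [t ht] := below; exists t.
have [|t [t1 t2]] := IH; first by move=> c d cs; apply: h; rewrite inE cs orbT.
have [a_t|t_a] := ltP a t.
  by exists t; split=> // c; rewrite inE => /orP[/eqP->|/t1].
have [|t' a_t' ht'] := between a; first by move=> b; apply: h; rewrite inE eqxx.
exists t'; split=> // c; rewrite inE => /orP[/eqP->//|/t1 ct].
exact: lt_trans ct (le_lt_trans t_a a_t').
Qed.

(** A form of negative slope is nonnegative to the left of its root, one of positive slope to the
    right. If all roots of the first kind lay below all roots of the second, every sloped form would
    be negative at a point between them, so a constant form would do the covering; otherwise two
    forms of opposite slopes are nonnegative at a common point and their slopes can be cancelled. *)
Lemma affine_cover_combination (R : realFieldType) (l : seq (R * R)) :
  (forall t, exists2 i, i \in l & 0 <= i.1 + i.2 * t) ->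
  exists i j, exists2 a, [/\ i \in l, j \in l & 0 <= a <= 1] &
    a * i.2 + (1 - a) * j.2 = 0 /\ 0 <= a * i.1 + (1 - a) * j.1.
Proof.
move=> cov; apply: contrapT => no.
pose lo := [seq - i.1 / i.2 | i <- l & i.2 < 0].
pose hi := [seq - i.1 / i.2 | i <- l & 0 < i.2].
have [|t [tlo thi]] := @seq_separation R lo hi.
  move=> _ _ /mapP[j + ->] /mapP[i + ->].
  rewrite !mem_filter => /andP[j0 jl] /andP[i0 il].
  rewrite ltNge; apply/negP => ij; apply: no; exists i, j.
  have d0 : 0 < i.2 - j.2 by lra.
  (* The weight that cancels the slopes [i.2 > 0] and [j.2 < 0]. *)
  exists (- j.2 / (i.2 - j.2)); first split=> //.
    by rewrite divr_ge0 ?ler_pdivrMr; lra.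
  have -> : 1 - - j.2 / (i.2 - j.2) = i.2 / (i.2 - j.2) by field; lra.
  split; first by field; lra.
  rewrite ![_ / _ * _]mulrAC -mulrDl divr_ge0 ?(ltW d0)//.
  move: ij; rewrite ler_pdivrMr// mulrAC ler_ndivlMr//; lra.
have [i il it] := cov t.
have [i0|i0|i0] := ltgtP i.2 0.
- have /tlo : - i.1 / i.2 \in lo by apply/mapP; exists i; rewrite ?mem_filter ?i0.
  by rewrite ltr_ndivrMr//; lra.
- have /thi : - i.1 / i.2 \in hi by apply/mapP; exists i; rewrite ?mem_filter ?i0.
  by rewrite ltr_pdivlMr//; lra.
- apply: no; exists i, i, 1; first by rewrite ler01 lexx.
  by move: it; rewrite i0; split; lra.
Qed.

(** * Order, suprema and norm in a Banach lattice *)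

Section BanachLattice.
Context (R : realType) (E : completeNormedModType R) (L : lattice_on E).
Hypothesis hL : is_banach_lattice L.
Local Notation "x <=L y" := (lle L x y) (at level 70, no associativity).
Local Notation "x `v` y" := (lsup L x y) (at level 48, left associativity).
Implicit Types x y z w : E.

Lemma lle_refl x : x <=L x. Proof. by case: hL. Qed.

Lemma lle_anti x y : x <=L y -> y <=L x -> x = y. Proof. by case: hL => _ + _ _ _; apply. Qed.

Lemma lle_trans y x z : x <=L y -> y <=L z -> x <=L z.
Proof. by case: hL => _ _ + _ _; apply. Qed.

Lemma lleD2r z x y : x <=L y -> x + z <=L y + z.
Proof. by case: hL => _ _ _ + _; apply. Qed.

Lemma lleZ (a : R) x y : 0 <= a -> x <=L y -> a *: x <=L a *: y.
Proof. by case: hL => _ _ _ _ [+ _ _]; apply. Qed.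

Lemma lle_supl x y : x <=L x `v` y. Proof. by case: hL => _ _ _ _ [_ + _] => /(_ x y)[]. Qed.

Lemma lle_supr x y : y <=L x `v` y. Proof. by case: hL => _ _ _ _ [_ + _] => /(_ x y)[]. Qed.

Lemma lsup_le x y z : x <=L z -> y <=L z -> x `v` y <=L z.
Proof. by case: hL => _ _ _ _ [_ + _] => /(_ x y)[_ _]; apply. Qed.

Lemma lle_norm x y : labs L x <=L labs L y -> `|x| <= `|y|.
Proof. by case: hL => _ _ _ _ [_ _]; apply. Qed.

Lemma lleD x y z w : x <=L y -> z <=L w -> x + z <=L y + w.
Proof.
move=> xy zw; apply: lle_trans (lleD2r z xy) _.
by rewrite ![y + _]addrC; exact: lleD2r.
Qed.

Lemma lle_subr z x y : x + z <=L y <-> x <=L y - z.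
Proof.
split=> h; first by rewrite -(addrK z x); exact: lleD2r.
by rewrite -(subrK z y); exact: lleD2r.
Qed.

Lemma lleN x y : x <=L y -> - y <=L - x.
Proof. by move=> /(lleD2r (- x - y)); rewrite addrA subrr add0r addrCA subrr addr0. Qed.

Lemma lsup_mono x y z w : x <=L z -> y <=L w -> x `v` y <=L z `v` w.
Proof.
move=> xz yw; apply: lsup_le.
  by apply: lle_trans xz _; exact: lle_supl.
by apply: lle_trans yw _; exact: lle_supr.
Qed.

Lemma lsup_r x y : x <=L y -> x `v` y = y.
Proof.
move=> xy; apply: lle_anti; last exact: lle_supr.
by apply: lsup_le => //; exact: lle_refl.
Qed.

Lemma lsupC x y : x `v` y = y `v` x.
Proof. by apply: lle_anti; apply: lsup_le; (exact: lle_supl || exact: lle_supr). Qed.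

Lemma lsupDr z x y : (x + z) `v` (y + z) = x `v` y + z.
Proof.
apply: lle_anti.
  by apply: lsup_le; apply: lleD2r; [exact: lle_supl | exact: lle_supr].
apply/lle_subr; apply: lsup_le; apply/lle_subr;
  [exact: lle_supl | exact: lle_supr].
Qed.

Lemma lsupZ (a : R) x y : 0 <= a -> (a *: x) `v` (a *: y) = a *: (x `v` y).
Proof.
rewrite le_eqVlt => /predU1P[<-|a0].
  by rewrite !scale0r lsup_r//; exact: lle_refl.
have ai : 0 <= a^-1 by rewrite invr_ge0 ltW.
apply: lle_anti.
  by apply: lsup_le; apply: lleZ (ltW a0) _; [exact: lle_supl | exact: lle_supr].
rewrite -[X in _ <=L X](scalerKV (lt0r_neq0 a0)); apply: lleZ (ltW a0) _.
by apply: lsup_le; [rewrite -[X in X <=L _](scalerK (lt0r_neq0 a0))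
  |rewrite -[X in X <=L _](scalerK (lt0r_neq0 a0))];
  apply: lleZ ai _; [exact: lle_supl | exact: lle_supr].
Qed.

Lemma lle_labs x : x <=L labs L x. Proof. exact: lle_supl. Qed.

Lemma lleN_labs x : - x <=L labs L x. Proof. exact: lle_supr. Qed.

Lemma labs_le x y : x <=L y -> - x <=L y -> labs L x <=L y.
Proof. exact: lsup_le. Qed.

Lemma labs_ge0 x : 0 <=L labs L x.
Proof.
have := lleD (lle_labs x) (lleN_labs x).
rewrite subrr -[_ + _]mulr2n -scaler_nat => /(lleZ (a := 2^-1)).
by rewrite scaler0 scalerA mulVf// scale1r; apply; rewrite invr_ge0.
Qed.

Lemma labs_id x : 0 <=L x -> labs L x = x.
Proof.
move=> x0; rewrite /labs lsupC lsup_r//; apply: lle_trans (x0).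
by rewrite -[X in _ <=L X]oppr0; exact: lleN.
Qed.

Lemma norm_labs x : `|labs L x| = `|x|.
Proof.
by apply/eqP; rewrite eq_le; apply/andP; split; apply: lle_norm;
  rewrite (labs_id (labs_ge0 x)); exact: lle_refl.
Qed.

Lemma norm_le x y : labs L x <=L y -> `|x| <= `|y|.
Proof.
move=> xy; apply: lle_norm; rewrite (@labs_id y)//.
exact: lle_trans (labs_ge0 x) xy.
Qed.

(** Adding the moduli of [x - z] and [y - w] to [lsup L z w] dominates [lsup L x y], and
    symmetrically; monotonicity of the norm does the rest. This carries suprema through limits. *)
Lemma lsup_lip x y z w : `|x `v` y - z `v` w| <= `|x - z| + `|y - w|.
Proof.
rewrite -(norm_labs (x - z)) -(norm_labs (y - w)).
set a := labs L (x - z); set b := labs L (y - w).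
apply: le_trans (ler_normD a b); apply: norm_le.
have a0 : 0 <=L a := labs_ge0 _.
have b0 : 0 <=L b := labs_ge0 _.
have step u v s t : labs L (u - s) = a -> labs L (v - t) = b ->
    u `v` v - s `v` t <=L a + b.
  move=> ha hb; apply/lle_subr; rewrite opprK.
  rewrite addrC -lsupDr; apply: lsup_mono.
    rewrite -[X in X <=L _](subrK s) addrC; apply: lleD; first exact: lle_refl.
    by rewrite -[X in X <=L _]addr0; apply: lleD => //; rewrite -ha; exact: lle_labs.
  rewrite -[X in X <=L _](subrK t) addrC; apply: lleD; first exact: lle_refl.
  by rewrite -[X in X <=L _]add0r; apply: lleD => //; rewrite -hb; exact: lle_labs.
apply: labs_le; first exact: step.
rewrite opprB; apply: step; rewrite /labs.
  by rewrite -opprB opprK lsupC.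
by rewrite -opprB opprK lsupC.
Qed.

(** * The vector lattice generated by two elements *)

Section Generated.
Variables x y : E.

(** A relation rather than a function, since one function can be written as a maximum of forms in
    several ways; that its value in [E] does not depend on the writing follows from [subl_le]. *)
Inductive subl : (R * R -> R) -> E -> Prop :=
| subl_lin a b : subl (fun u => a * u.1 + b * u.2) (a *: x + b *: y)
| subl_max F z G w : subl F z -> subl G w ->
    subl (fun u => Num.max (F u) (G u)) (z `v` w).

Lemma subl_forms F z : subl F z -> exists2 l : seq (R * R),
  (forall u, exists2 i, i \in l & F u = i.1 * u.1 + i.2 * u.2) &
  (forall i, i \in l -> i.1 *: x + i.2 *: y <=L z).
Proof.
elim=> [a b|{}F {}z G w _ [l1 F1 z1] _ [l2 G2 w2]].
  exists [:: (a, b)] => [u|i]; first by exists (a, b); rewrite ?inE.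
  by rewrite inE => /eqP -> /=; exact: lle_refl.
exists (l1 ++ l2) => [u|i].
  have [FG|GF] := leP (F u) (G u).
    by have [i il ->] := G2 u; exists i; rewrite ?mem_cat ?il ?orbT.
  by have [i il ->] := F1 u; exists i; rewrite ?mem_cat ?il.
rewrite mem_cat => /orP[/z1|/w2] h; apply: lle_trans h _.
  exact: lle_supl.
exact: lle_supr.
Qed.

Lemma subl_ge0 F z : subl F z -> (forall u, 0 <= F u) -> 0 <=L z.
Proof.
move=> /subl_forms[l Fl lz] F0.
(* On the line [u.1 = s] the forms are affine in [u.2]. The combination of slope zero has no [y]
   term, and leaves a multiple of [x] below [z]. *)
have half (s : R) : exists2 c, 0 <= c * s & c *: x <=L z.
  have [|i [j [a [il jl /andP[a0 a1]] [e0 e1]]]] :=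
      @affine_cover_combination R [seq (i.1 * s, i.2) | i <- l].
    move=> t; have [i il Fi] := Fl (s, t); exists (i.1 * s, i.2).
      by apply/mapP; exists i.
    by rewrite /= -Fi.
  move: il jl e0 e1 => /mapP[i' il ->] /mapP[j' jl ->] /= e0 e1.
  exists (a * i'.1 + (1 - a) * j'.1); first by rewrite mulrDl -!mulrA.
  have := lleD (lleZ a0 (lz _ il)) (lleZ (a := 1 - a) _ (lz _ jl)).
  rewrite subr_ge0 -scalerDl [a + _]addrC subrK scale1r => /(_ a1).
  rewrite !scalerDr !scalerA addrACA -!scalerDl e0 scale0r addr0.
  by [].
have [c c0 cz] := half 1; have [d d0 dz] := half (-1).
rewrite mulr1 in c0; rewrite mulrN1 oppr_ge0 in d0.
have [c00|cn0] := eqVneq c 0; first by move: cz; rewrite c00 scale0r.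
have cd : 0 < c - d by rewrite lt_neqAle in c0 *; lra.
(* The nonnegative weights [- d] and [c] cancel the two multiples of [x], leaving
   [0 <= (c - d) z]. *)
have := lleD (lleZ (a := - d) _ cz) (lleZ c0 dz).
have -> : - d *: (c *: x) + c *: (d *: x) = 0.
  by rewrite !scalerA -scalerDl mulNr [c * d]mulrC addNr scale0r.
rewrite -scalerDl oppr_ge0 => /(_ d0)/(lleZ (a := (c - d)^-1)).
rewrite scaler0 [- d + c]addrC scalerA mulVf ?gt_eqF// scale1r invr_ge0.
by apply; exact: ltW.
Qed.

Lemma subl_add F z G w : subl F z -> subl G w -> subl (fun u => F u + G u) (z + w).
Proof.
move=> + sG; elim=> [a b|{}F {}z F' z' sF IF sF' IF'].
  elim: sG => [c d|{}G {}w G' w' sG IG sG' IG'].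
    rewrite addrACA -!scalerDl.
    by under eq_fun do rewrite addrACA -!mulrDl; exact: subl_lin.
  rewrite addrC -lsupDr ![_ + (_ *: x + _)]addrC.
  under eq_fun do rewrite addr_maxr.
  exact: subl_max.
rewrite -lsupDr; under eq_fun do rewrite addr_maxl.
exact: subl_max.
Qed.

Lemma subl_scale (c : R) F z : 0 <= c -> subl F z -> subl (fun u => c * F u) (c *: z).
Proof.
move=> c0; elim=> [a b|{}F {}z F' z' sF IF sF' IF'].
  rewrite scalerDr !scalerA.
  by under eq_fun do rewrite mulrDr !mulrA; exact: subl_lin.
rewrite -lsupZ//; under eq_fun do rewrite maxr_pMr//.
exact: subl_max.
Qed.

(** A difference of maxima need not be a maximum of forms, so the left side is first split by the
    universal property of the supremum. Once it is a linear form its negative is available, and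
    [subl_ge0] applies. *)
Lemma subl_le F z G w : subl F z -> subl G w -> (forall u, F u <= G u) -> z <=L w.
Proof.
move=> + sG; elim=> [a b|{}F {}z F' z' sF IF sF' IF'] FG.
  have := subl_ge0 (subl_add (subl_lin (- a) (- b)) sG).
  rewrite !scaleNr -opprD addrC -lle_subr add0r; apply=> u.
  by have := FG u; lra.
by apply: lsup_le; [apply: IF | apply: IF'] => u; have := FG u; rewrite ge_max => /andP[].
Qed.

(** Differences make the relation closed under negation, while maxima remain available by
    [gen_max]. *)
Definition gen (F : R * R -> R) (z : E) : Prop :=
  exists F1 z1 F2 z2, [/\ subl F1 z1, subl F2 z2, F = (fun u => F1 u - F2 u) & z = z1 - z2].

Lemma gen_subl F z : subl F z -> gen F z.
Proof.
move=> sF; exists F, z, (fun u => 0 * u.1 + 0 * u.2), (0 *: x + 0 *: y); split=> //.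
- exact: subl_lin.
- by apply/funext => u; rewrite !mul0r addr0 subr0.
- by rewrite !scale0r addr0 subr0.
Qed.

Lemma gen_lin a b : gen (fun u => a * u.1 + b * u.2) (a *: x + b *: y).
Proof. by apply: gen_subl; exact: subl_lin. Qed.

Lemma gen_fst : gen fst x.
Proof.
have := gen_lin 1 0; rewrite scale1r scale0r addr0.
by congr gen; apply/funext => u; rewrite mul1r mul0r addr0.
Qed.

Lemma gen_snd : gen snd y.
Proof.
have := gen_lin 0 1; rewrite scale1r scale0r add0r.
by congr gen; apply/funext => u; rewrite mul1r mul0r add0r.
Qed.

Lemma gen_add F z G w : gen F z -> gen G w -> gen (fun u => F u + G u) (z + w).
Proof.
move=> [F1 [z1 [F2 [z2 [s1 s2 -> ->]]]]] [G1 [w1 [G2 [w2 [t1 t2 -> ->]]]]].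
exists (fun u => F1 u + G1 u), (z1 + w1), (fun u => F2 u + G2 u), (z2 + w2).
split; try exact: subl_add; last by rewrite addrACA opprD.
by apply/funext => u; rewrite addrACA opprD.
Qed.

Lemma gen_opp F z : gen F z -> gen (fun u => - F u) (- z).
Proof.
move=> [F1 [z1 [F2 [z2 [s1 s2 -> ->]]]]]; exists F2, z2, F1, z1; split=> //.
  by apply/funext => u; rewrite opprB.
by rewrite opprB.
Qed.

Lemma gen_scale (c : R) F z : gen F z -> gen (fun u => c * F u) (c *: z).
Proof.
wlog c0 : c F z / 0 <= c => [ih gF|].
  have [c0|c0] := leP 0 c; first exact: ih.
  have := gen_opp (ih (- c) F z _ gF).
  rewrite scaleNr opprK oppr_ge0 => /(_ (ltW c0)).
  by under eq_fun do rewrite mulNr opprK.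
move=> [F1 [z1 [F2 [z2 [s1 s2 -> ->]]]]].
exists (fun u => c * F1 u), (c *: z1), (fun u => c * F2 u), (c *: z2).
split; try exact: subl_scale; last by rewrite scalerBr.
by apply/funext => u; rewrite mulrBr.
Qed.

Lemma gen_max F z G w : gen F z -> gen G w -> gen (fun u => Num.max (F u) (G u)) (z `v` w).
Proof.
move=> [F1 [z1 [F2 [z2 [s1 s2 -> ->]]]]] [G1 [w1 [G2 [w2 [t1 t2 -> ->]]]]].
(* Adding [F2 + G2] to both [F1 - F2] and [G1 - G2] clears the subtractions inside the maximum. *)
exists (fun u => Num.max (F1 u + G2 u) (G1 u + F2 u)), ((z1 + w2) `v` (w1 + z2)).
exists (fun u => F2 u + G2 u), (z2 + w2); split.
- by apply: subl_max; exact: subl_add.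
- exact: subl_add.
- apply/funext => u; rewrite addr_maxl; congr Num.max; lra.
- rewrite -lsupDr; congr lsup; first by rewrite opprD addrACA subrr addr0.
  by rewrite [z2 + _]addrC opprD addrACA subrr addr0.
Qed.

Lemma gen_le F z G w : gen F z -> gen G w -> (forall u, F u <= G u) -> z <=L w.
Proof.
move=> [F1 [z1 [F2 [z2 [s1 s2 -> ->]]]]] [G1 [w1 [G2 [w2 [t1 t2 -> ->]]]]] FG.
have : z1 + w2 <=L w1 + z2.
  apply: subl_le (subl_add s1 t2) (subl_add t1 s2) _ => u.
  by have := FG u; lra.
by move=> /(lleD2r (- z2 - w2)); rewrite addrACA subrr addr0 addrA addrK.
Qed.

Lemma gen_labs F z : gen F z -> gen (fun u => `|F u|) (labs L z).
Proof.
move=> gF; have := gen_max gF (gen_opp gF); congr gen.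
by apply/funext => u; rewrite maxrN.
Qed.

(** The norm on [R * R] is the maximum norm, so this is the value of [u |-> |u|] at [(x, y)]: the
    unit against which homogeneous functions are measured. *)
Definition gunit : E := labs L x `v` labs L y.

Lemma gen_norm : gen (fun u => `|u|) gunit.
Proof. exact: gen_max (gen_labs gen_fst) (gen_labs gen_snd). Qed.

Lemma gen_norm_le (e : R) F z : gen F z -> (forall u, `|F u| <= e * `|u|) -> `|z| <= e * `|gunit|.
Proof.
move=> gF Fe.
have e0 : 0 <= e.
  by have := Fe (1, 1); rewrite prod_normE/= maxxx normr1 mulr1; exact: le_trans.
rewrite -[X in X * _](ger0_norm e0) -normrZ; apply: norm_le.
exact: gen_le (gen_labs gF) (gen_scale e gen_norm) Fe.
Qed.

End Generated.
End BanachLattice.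

Local Open Scope classical_set_scope.

(** * Continuous positively homogeneous functions on the plane *)

Section PositivelyHomogeneous.
Context (R : realType).
Implicit Types F G : R * R -> R.

Lemma H2_fst : H2 (@fst R R).
Proof. by split=> // u; exact: cvg_fst. Qed.

Lemma H2_snd : H2 (@snd R R).
Proof. by split=> // u; exact: cvg_snd. Qed.

Lemma H2_add F G : H2 F -> H2 G -> H2 (fun u => F u + G u).
Proof.
move=> [cF hF] [cG hG]; split=> [u|a u a0]; last by rewrite hF// hG// mulrDr.
exact: (cvgD (cF u) (cG u)).
Qed.

Lemma H2_scale (c : R) F : H2 F -> H2 (fun u => c * F u).
Proof.
move=> [cF hF]; split=> [u|a u a0]; last by rewrite hF// mulrCA.
exact: (cvgMr (cF u)).
Qed.

Lemma H2_opp F : H2 F -> H2 (fun u => - F u).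
Proof. by move/(H2_scale (-1)); under eq_fun do rewrite mulN1r. Qed.

Lemma H2_max F G : H2 F -> H2 G -> H2 (fun u => Num.max (F u) (G u)).
Proof.
move=> [cF hF] [cG hG]; split=> [u|a u a0]; last by rewrite hF// hG// maxr_pMr.
exact: (@continuous_max _ _ (F : _ -> R^o) (G : _ -> R^o) u (cF u) (cG u)).
Qed.

Lemma H2_norm F : H2 F -> H2 (fun u => `|F u|).
Proof.
move=> [cF hF]; split=> [u|a u a0]; last by rewrite hF// normrM ger0_norm.
exact: (cvg_norm (cF u)).
Qed.

Lemma H2_comp F G K : H2 F -> H2 G -> H2 K -> H2 (fun u => F (G u, K u)).
Proof.
move=> [cF hF] [cG hG] [cK hK]; split=> [u|a u a0].
  apply: (@continuous_comp _ _ _ (fun u => (G u, K u)) F); last exact: cF.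
  exact: (cvg_pair (cG u) (cK u)).
by rewrite hG// hK//; exact: (hF a (G u, K u)).
Qed.

(** Homogeneity carries the inequality along rays, and at the origin it forces both values to be 0.
    Comparisons thus reduce to the compact unit sphere. *)
Lemma H2_bound F G : H2 F -> H2 G -> (forall u, `|u| = 1 -> F u <= G u) ->
  forall u, F u <= G u.
Proof.
move=> [_ hF] [_ hG] FG u.
have [u0|u0] := eqVneq `|u| 0.
  have -> : u = (0 * u.1, 0 * u.2).
    by move/normr0_eq0: u0 => ->; rewrite /= !mul0r.
  by rewrite hF// hG// !mul0r.
pose v : R * R := (`|u|^-1 * u.1, `|u|^-1 * u.2).
have uv : u = (`|u| * v.1, `|u| * v.2).
  by rewrite /= !mulrA divff// !mul1r; case: (u).
rewrite uv hF// hG// ler_wpM2l// FG// prod_normE/= !normrM !normfV normr_id.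
by rewrite -maxr_pMr ?invr_ge0// -[Num.max _ _]/(`|u|) mulVf.
Qed.

Lemma compact_unit_sphere : compact [set u : R * R | `|u| = 1].
Proof.
apply: (@subclosed_compact _ _ (`[(-1 : R), 1] `*` `[(-1 : R), 1])%classic).
- apply: (closed_comp _ (@closed_eq _ 1)) => u _; exact: norm_continuous.
- by apply: compact_setX; exact: segment_compact.
- move=> u /=; rewrite prod_normE/= => u1; rewrite !in_itv/= -!ler_norml -u1.
  by rewrite !le_max !lexx orbT.
Qed.

End PositivelyHomogeneous.

(** * Existence, uniqueness and rules of the functional calculus *)

Section FunctionalCalculus.
Context (R : realType) (E : completeNormedModType R) (L : lattice_on E).
Hypothesis hL : is_banach_lattice L.
Local Notation gen := (gen L).
Implicit Types (F G : R * R -> R) (x y z w : E).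

Lemma subl_H2 x y F z : subl L x y F z -> H2 F.
Proof.
elim=> [a b|{}F {}z G w _ hF _ hG]; last exact: H2_max.
by apply: H2_add; apply: H2_scale; [exact: H2_fst | exact: H2_snd].
Qed.

Lemma gen_H2 x y F z : gen x y F z -> H2 F.
Proof.
move=> [F1 [z1 [F2 [z2 [s1 s2 -> _]]]]].
by apply: H2_add; [exact: subl_H2 s1 | apply: H2_opp; exact: subl_H2 s2].
Qed.

(* Near [u] a steep cone with apex [F u]: it meets [F] at [u] and stays below [F + e] elsewhere. *)
Lemma gen_minorant x y F (e : R) (u : R * R) : H2 F -> 0 < e -> `|u| = 1 ->
  exists G z, [/\ gen x y G z, G u = F u & forall v, `|v| = 1 -> G v <= F v + e].
Proof.
move=> hF e0 u1; have [cF _] := hF.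
have [d /= d0 Fd] : exists2 d : R, 0 < d & forall v, `|u - v| < d -> `|F u - F v| < e.
  have /cvgrPdist_lt /(_ _ e0) /nbhs_ballP [d /= d0 Fd] := cF u.
  by exists d => // v uv; apply: Fd; rewrite -ball_normE.
have [c _ maxF] : exists2 c, c \in [set v : R * R | `|v| = 1] &
    forall v, v \in [set v : R * R | `|v| = 1] -> `|F v| <= `|F c|.
  apply: compact_EVT_max; [by exists u|exact: compact_unit_sphere|].
  by apply: continuous_subspaceT => v; exact: (cvg_norm (cF v)).
set B := `|F c| in maxF.
(* With this slope the cone has dropped by at least [2 * B] at distance [d], hence lies below
   [- B <= F v] there. *)
pose k := 2 * B / d.
have k0 : 0 <= k by rewrite divr_ge0 ?(ltW d0)// mulr_ge0// normr_ge0.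
have gn := gen_norm hL x y.
(* Constants are not homogeneous: [a] is replaced by [|v| * a], which agrees with it on the unit
   sphere. *)
have gcoord a H w : gen x y H w -> exists z, gen x y (fun v => `| `|v| * a - H v|) z.
  move=> gH; exists (labs L (a *: gunit L x y - w)).
  have -> : (fun v => `| `|v| * a - H v|) = (fun v => `|a * `|v| - H v|).
    by apply/funext => v; rewrite mulrC.
  apply: (gen_labs hL (F := fun v => a * `|v| - H v)).
  by apply: gen_add (gen_opp gH) => //; exact: gen_scale.
have [z1 g1] := gcoord u.1 fst x (gen_fst L x y).
have [z2 g2] := gcoord u.2 snd y (gen_snd L x y).
exists (fun v => F u * `|v| - k * (`| `|v| * u.1 - v.1| + `| `|v| * u.2 - v.2|)).
exists (F u *: gunit L x y - k *: (z1 + z2)).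
split.
- exact: (gen_add hL (gen_scale hL (F u) gn)
    (gen_opp (gen_scale hL k (gen_add hL g1 g2)))).
- by rewrite u1 !mul1r !subrr normr0 addr0 mulr0 subr0 mulr1.
move=> v v1; rewrite v1 !mul1r mulr1.
set S := `|_| + `|_|.
have S0 : 0 <= S by rewrite addr_ge0.
have [uv|uv] := ltP `|u - v| d.
  have := Fd _ uv; rewrite ltr_norml => /andP[_].
  by have := mulr_ge0 k0 S0; lra.
have dS : d <= S.
  apply: le_trans uv _; rewrite prod_normE/= ge_max /S.
  by rewrite lerDl lerDr !normr_ge0.
have kS : 2 * B <= k * S.
  by rewrite -[X in X <= _](divfK (lt0r_neq0 d0)) ler_wpM2l.
have := maxF u; rewrite inE => /(_ u1); rewrite ler_norml => /andP[_ Fu].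
have := maxF v; rewrite inE => /(_ v1); rewrite ler_norml => /andP[Fv _].
lra.
Qed.

(** A lattice form of the Stone-Weierstrass theorem: the cones of [gen_minorant] stay below [F + e]
    on the sphere and exceed [F - e] near their apex, so by compactness a finite maximum of them is
    within [e] of [F]. *)
Lemma gen_dense x y F (e : R) : H2 F -> 0 < e ->
  exists G z, gen x y G z /\ forall u, `|F u - G u| <= e * `|u|.
Proof.
move=> hF e0.
(* The finite subcover is taken through a filter on functions, based on the sets of functions above
   an admissible one; closure of [good] under maxima makes it a filter, and near-covering
   compactness returns one admissible function for the whole sphere. *)
pose good H := (exists z, gen x y H z) /\ forall v, `|v| = 1 -> H v <= F v + e.
pose above H := [set H' : R * R -> R | forall v, H v <= H' v].
have fil : Filter (filter_from good above).
  apply: filter_from_filter.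
    have one : `|(1, 1) : R * R| = 1 by rewrite prod_normE/= normr1 maxxx.
    have [G [z [gz _ le]]] := gen_minorant x y hF e0 one.
    by exists G; split=> //; exists z.
  move=> G H [[z gG] GF] [[w gH] HF].
  exists (fun v => Num.max (G v) (H v)).
    split; first by exists (lsup L z w); exact: gen_max.
    by move=> v v1; rewrite ge_max GF//= HF.
  by move=> M GHM; split=> v; apply: le_trans (GHM v); rewrite le_max lexx ?orbT.
have /compact_near_coveringP := @compact_unit_sphere R.
move=> /(_ _ (filter_from good above) (fun H u => F u - H u < e) fil) [].
  move=> u u1; have [G [z [gG Gu Gle]]] := gen_minorant x y hF e0 u1.
  exists ([set v | F v - G v < e], above G) => /=.
    split; last by exists G => //; split=> //; exists z.
    have cFG : continuous (fun v => F v - G v) by case: (H2_add hF (H2_opp (gen_H2 gG))).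
    have /(cFG u) : nbhs (F u - G u) [set t | t < e]; last by [].
    by apply: open_nbhs_nbhs; split; [exact: open_lt|rewrite /= Gu subrr].
  by move=> [v H] /= [vG GH]; apply: le_lt_trans vG; rewrite lerB.
move=> H [[z gH] HF] /(_ H (fun=> lexx _)) FH.
exists H, z; split=> //.
have hH := gen_H2 gH.
apply: H2_bound; first exact: H2_norm (H2_add hF (H2_opp hH)).
  by apply: H2_scale; exact: gen_H2 (gen_norm hL x y).
move=> u u1; rewrite u1 mulr1 ler_norml; have := HF u u1.
have := FH u u1; lra.
Qed.

(* Stands for [F(x, y) = z] until the calculus is known to exist. *)
Definition appr x y F z := forall e : R, 0 < e -> exists G w,
  [/\ gen x y G w, forall u, `|F u - G u| <= e * `|u| & `|z - w| <= e].

Lemma small_eq0 (c : R) z : (forall e : R, 0 < e -> `|z| <= c * e) -> z = 0.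
Proof.
move=> h; apply/eqP; rewrite -normr_le0; apply/ler_addgt0Pr => e e0.
rewrite add0r; have [c0|c0] := leP c 0.
  apply: le_trans (h _ e0) _; apply: le_trans (ltW e0).
  by rewrite mulr_le0_ge0// ltW.
by have := h _ (divr_gt0 e0 c0); rewrite mulrC divfK// gt_eqF.
Qed.

Lemma gen_dist x y F z G w (e : R) : gen x y F z -> gen x y G w ->
  (forall u, `|F u - G u| <= e * `|u|) -> `|z - w| <= e * `|gunit L x y|.
Proof. by move=> gF gG; apply: gen_norm_le => //; exact: gen_add (gen_opp gG). Qed.

Lemma appr_uniq x y F z w : appr x y F z -> appr x y F w -> z = w.
Proof.
move=> az aw; apply/eqP; rewrite -subr_eq0; apply/eqP.
apply: (@small_eq0 (2 + 2 * `|gunit L x y|)) => e e0.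
have [G [z' [gG FG zz']]] := az _ e0; have [H [w' [gH FH ww']]] := aw _ e0.
have : `|z' - w'| <= (2 * e) * `|gunit L x y|.
  apply: gen_dist gG gH _ => u; rewrite -(subrK (F u) (G u)) -addrA.
  by apply: le_trans (ler_normD _ _) _; rewrite distrC; have := FG u; have := FH u; lra.
have -> : z - w = (z - z') + (z' - w') - (w - w').
  by rewrite addrA subrK opprB addrA subrK.
have := ler_normB (z - z' + (z' - w')) (w - w').
have := ler_normD (z - z') (z' - w').
lra.
Qed.

Lemma appr_gen x y F z : gen x y F z -> appr x y F z.
Proof.
by move=> gF e e0; exists F, z; split=> // [u|]; rewrite subrr normr0 ?mulr_ge0 ?(ltW e0).
Qed.

Lemma appr_add x y F z G w : appr x y F z -> appr x y G w ->
  appr x y (fun u => F u + G u) (z + w).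
Proof.
move=> aF aG e e0; have e2 : 0 < e / 2 by rewrite divr_gt0.
have [F' [z' [gF FF zz]]] := aF _ e2; have [G' [w' [gG GG ww]]] := aG _ e2.
exists (fun u => F' u + G' u), (z' + w'); split; first exact: gen_add.
  move=> u; rewrite opprD addrACA; apply: le_trans (ler_normD _ _) _.
  by have := FF u; have := GG u; lra.
by rewrite opprD addrACA; apply: le_trans (ler_normD _ _) _; lra.
Qed.

Lemma appr_scale x y (c : R) F z : appr x y F z -> appr x y (fun u => c * F u) (c *: z).
Proof.
move=> aF e e0; have c1 : 0 < `|c| + 1 by rewrite ltr_wpDl.
have [F' [z' [gF FF zz]]] := aF _ (divr_gt0 e0 c1).
have ce : `|c| * (e / (`|c| + 1)) <= e.
  by rewrite mulrA ler_pdivrMr// mulrC ler_wpM2l ?ltW// ltrDl.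
exists (fun u => c * F' u), (c *: z'); split; first exact: gen_scale.
  move=> u; rewrite -mulrBr normrM; apply: le_trans (ler_wpM2l _ (FF u)) _ => //.
  by rewrite mulrA ler_wpM2r.
rewrite -scalerBr normrZ; exact: le_trans (ler_wpM2l _ zz) ce.
Qed.

Lemma max_lip (a b c d : R) : `|Num.max a b - Num.max c d| <= `|a - c| + `|b - d|.
Proof.
have := ler_norm (a - c); have := ler_norm (b - d).
have := lerNnormlW (lexx `|a - c|); have := lerNnormlW (lexx `|b - d|).
have := normr_ge0 (a - c); have := normr_ge0 (b - d).
by rewrite ler_norml; case: (leP a b); case: (leP c d); lra.
Qed.

Lemma appr_max x y F z G w : appr x y F z -> appr x y G w ->
  appr x y (fun u => Num.max (F u) (G u)) (lsup L z w).
Proof.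
move=> aF aG e e0; have e2 : 0 < e / 2 by rewrite divr_gt0.
have [F' [z' [gF FF zz]]] := aF _ e2; have [G' [w' [gG GG ww]]] := aG _ e2.
exists (fun u => Num.max (F' u) (G' u)), (lsup L z' w'); split; first exact: gen_max.
  move=> u; apply: le_trans (max_lip _ _ _ _) _.
  by have := FF u; have := GG u; lra.
by apply: le_trans (lsup_lip hL _ _ _ _) _; lra.
Qed.

(** Values of generated functions approaching [F] uniformly on the sphere form a Cauchy sequence,
    and [E] is complete. *)
Lemma appr_exists x y F : H2 F -> exists z, appr x y F z.
Proof.
move=> hF; pose g := `|gunit L x y|.
(* The added 1 keeps the divisor positive when [x] and [y] both vanish. *)
have g1 : 0 < 2 * g + 1 by rewrite ltr_wpDl ?mulr_ge0// normr_ge0.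
have /choice[G GP] : forall n, exists G, exists z, gen x y G z /\
    forall u, `|F u - G u| <= n.+1%:R^-1 * `|u|.
  by move=> n; apply: gen_dense; rewrite ?invr_gt0.
have /choice[w wP] := GP.
have ww n m (e : R) : n.+1%:R^-1 <= e -> m.+1%:R^-1 <= e ->
    `|w n - w m| <= 2 * e * g.
  move=> ne me; have [g1' F1] := wP n; have [g2' F2] := wP m.
  apply: gen_dist g1' g2' _ => u; rewrite -(subrK (F u) (G n u)) -addrA.
  apply: le_trans (ler_normD _ _) _; rewrite distrC.
  have := F1 u; have := F2 u.
  move: ne me; set a := n.+1%:R^-1; set b := m.+1%:R^-1 => ne me.
  by have := ler_wpM2r (normr_ge0 u) ne; have := ler_wpM2r (normr_ge0 u) me; lra.
have small (e : R) : 0 < e -> \forall n \near \oo, n.+1%:R^-1 <= e.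
  move=> e0; have /cvgrPdist_le/(_ _ e0) := @cvg_harmonic R.
  by apply: filterS => n /=; rewrite sub0r normrN /harmonic/= ger0_norm.
have : cvg (w @ \oo).
  apply/cauchy_cvgP/cauchy_exP => e e0.
  have e1 : 0 < e / (2 * g + 1) by rewrite divr_gt0.
  have [N _ NP] := small _ e1; exists (w N); exists N => // n Nn /=.
  rewrite -ball_normE /=; apply: le_lt_trans (ww _ _ _ (NP N _) (NP n Nn)) _ => //=.
  have -> : 2 * (e / (2 * g + 1)) * g = 2 * g * e / (2 * g + 1) by ring.
  by rewrite ltr_pdivrMr//; lra.
move=> /cvg_ex[z /cvgrPdist_le wz]; exists z => e e0.
have [n [ne zn]] := filter_ex (filterI (small _ e0) (wz _ e0)).
have [gn Fn] := wP n; exists (G n), (w n); split=> // u.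
by apply: le_trans (Fn u) _; rewrite ler_wpM2r.
Qed.

(** The homomorphism sends each function to its limit value. Uniqueness of that value turns the
    closure properties of [appr] into the homomorphism laws; on [H2] the default 0 is never
    reached. *)
Lemma appr_krivine_rel x y F z : appr x y F z -> krivine_rel L x y F z.
Proof.
move=> aF; exists (fun G => xget 0 [set w | appr x y G w]).
have val G w : appr x y G w -> xget 0 [set w | appr x y G w] = w.
  by move=> aG; apply: xget_unique => // v av; exact: appr_uniq av aG.
have ex G : H2 G -> appr x y G (xget 0 [set w | appr x y G w]).
  by move=> /(appr_exists x y)[w aG]; rewrite (val _ _ aG).
split.
- by move=> G H hG hH; apply: val; apply: appr_add; exact: ex.
- by move=> a G hG; apply: val; apply: appr_scale; exact: ex.
- by move=> G H hG hH; apply: val; apply: appr_max; exact: ex.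
- split; apply: val => //; apply: appr_gen; [exact: gen_fst|exact: gen_snd].
Qed.

(** No continuity of the homomorphism is assumed: preserving maxima makes it monotone, and
    comparison with multiples of the norm function bounds it. It agrees with [gen] on generated
    functions, hence is the limit value on all of [H2]. *)
Lemma krivine_rel_appr x y F z : H2 F -> krivine_rel L x y F z -> appr x y F z.
Proof.
move=> hF [Phi [PD PZ PM [Px Py <-]]].
have Psubl G w : subl L x y G w -> Phi G = w.
  elim=> [a b|{}G {}w H v sG IG sH IH].
    rewrite PD; try (apply: H2_scale; (exact: H2_fst || exact: H2_snd)).
    by rewrite PZ ?Px; [rewrite PZ ?Py//; exact: H2_snd | exact: H2_fst].
  by rewrite PM ?IG ?IH//; [exact: subl_H2 sG | exact: subl_H2 sH].
have PB G H : H2 G -> H2 H -> Phi (fun u => G u - H u) = Phi G - Phi H.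
  move=> hG hH; rewrite -scaleN1r -PZ// -PD//; last exact: H2_scale.
  by congr Phi; apply/funext => u; rewrite mulN1r.
have Pgen G w : gen x y G w -> Phi G = w.
  move=> [G1 [w1 [G2 [w2 [s1 s2 -> ->]]]]].
  by rewrite PB ?(Psubl _ _ s1) ?(Psubl _ _ s2)//; [exact: subl_H2 s1 | exact: subl_H2 s2].
have Ple G H : H2 G -> H2 H -> (forall u, G u <= H u) -> lle L (Phi G) (Phi H).
  move=> hG hH GH; have := PM _ _ hG hH.
  under eq_fun do rewrite max_r//.
  by move=> ->; exact: lle_supl.
move=> e e0; pose g := `|gunit L x y|.
have g1 : 0 < g + 1 by rewrite ltr_wpDl// normr_ge0.
have eg : e / (g + 1) <= e.
  by rewrite ler_pdivrMr// ler_peMr ?(ltW e0)// lerDr normr_ge0.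
have [G [w [gG FG]]] := gen_dense x y hF (divr_gt0 e0 g1).
exists G, w; split=> // [u|]; first by apply: le_trans (FG u) _; rewrite ler_wpM2r.
have hG := gen_H2 gG; rewrite -(Pgen _ _ gG) -PB//.
have hFG := H2_add hF (H2_opp hG).
have gn := gen_norm hL x y; have hn := gen_H2 gn.
have : labs L (Phi (fun u => F u - G u)) = Phi (fun u => `|F u - G u|).
  rewrite /labs -[- Phi _]scaleN1r -PZ// -PM//; last exact: H2_scale.
  by congr Phi; apply/funext => u; rewrite mulN1r maxrN.
move=> lF; apply: (@le_trans _ _ `|Phi (fun u => e / (g + 1) * `|u|)|).
  by apply: (norm_le hL); rewrite lF; apply: Ple => //; [exact: H2_norm|exact: H2_scale].
rewrite PZ// (Pgen _ _ gn) normrZ ger0_norm ?divr_ge0 ?(ltW e0) ?(ltW g1)//.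
by rewrite mulrAC ler_pdivrMr// ler_wpM2l ?ltW// ltrDl.
Qed.

Lemma krivine_eq x y F z : H2 F -> krivine_rel L x y F z -> krivine L F x y = z.
Proof.
move=> hF kz; apply: xget_unique => // w kw.
exact: appr_uniq (krivine_rel_appr hF kw) (krivine_rel_appr hF kz).
Qed.

Lemma krivineP x y F : H2 F -> appr x y F (krivine L F x y).
Proof.
move=> hF; have [z az] := appr_exists x y hF.
by rewrite (krivine_eq hF (appr_krivine_rel az)).
Qed.

Lemma krivine_appr x y F z : H2 F -> appr x y F z -> krivine L F x y = z.
Proof. by move=> hF az; apply: krivine_eq => //; exact: appr_krivine_rel. Qed.

Lemma krivine_fst x y : krivine L fst x y = x.
Proof. by apply: krivine_appr; [exact: H2_fst|apply: appr_gen; exact: gen_fst]. Qed.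

Lemma krivine_snd x y : krivine L snd x y = y.
Proof. by apply: krivine_appr; [exact: H2_snd|apply: appr_gen; exact: gen_snd]. Qed.

Lemma krivineD x y F G : H2 F -> H2 G ->
  krivine L (fun u => F u + G u) x y = krivine L F x y + krivine L G x y.
Proof.
move=> hF hG; apply: krivine_appr; first exact: H2_add.
by apply: appr_add; exact: krivineP.
Qed.

Lemma krivineZ x y (c : R) F : H2 F ->
  krivine L (fun u => c * F u) x y = c *: krivine L F x y.
Proof.
move=> hF; apply: krivine_appr; first exact: H2_scale.
by apply: appr_scale; exact: krivineP.
Qed.

Lemma krivine_max x y F G : H2 F -> H2 G ->
  krivine L (fun u => Num.max (F u) (G u)) x y = lsup L (krivine L F x y) (krivine L G x y).
Proof.
move=> hF hG; apply: krivine_appr; first exact: H2_max.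
by apply: appr_max; exact: krivineP.
Qed.

(** Precomposing with [(G, H)] and then evaluating at [(x, y)] is again a lattice homomorphism with
    the right values on the projections, so uniqueness applies. *)
Lemma krivine_comp x y F G H : H2 F -> H2 G -> H2 H ->
  krivine L F (krivine L G x y) (krivine L H x y) = krivine L (fun u => F (G u, H u)) x y.
Proof.
move=> hF hG hH; apply: krivine_eq => //.
exists (fun K => krivine L (fun u => K (G u, H u)) x y); split=> //.
- by move=> K K' hK hK'; rewrite krivineD//; exact: H2_comp.
- by move=> a K hK; rewrite krivineZ//; exact: H2_comp.
- by move=> K K' hK hK'; rewrite krivine_max//; exact: H2_comp.
Qed.

Lemma krivine_labs x y F : H2 F ->
  krivine L (fun u => `|F u|) x y = labs L (krivine L F x y).
Proof.
move=> hF; rewrite /labs -[- _]scaleN1r -krivineZ// -krivine_max//; last exact: H2_scale.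
by congr krivine; apply/funext => u; rewrite mulN1r maxrN.
Qed.

(** The bridge from pointwise inequalities to norm inequalities in [E], used in both
    implications. *)
Lemma krivine_norm_le x y F G : H2 F -> H2 G -> (forall u, `|F u| <= `|G u|) ->
  `|krivine L F x y| <= `|krivine L G x y|.
Proof.
move=> hF hG FG; apply: (lle_norm hL); rewrite -!krivine_labs//.
have <- : krivine L (fun u => Num.max `|F u| `|G u|) x y = krivine L (fun u => `|G u|) x y.
  by congr krivine; apply/funext => u; rewrite max_r.
by rewrite krivine_max; [exact: lle_supl|exact: H2_norm|exact: H2_norm].
Qed.

End FunctionalCalculus.

(** * Signed powers and scalar inequalities *)

Section SignedPower.
Context (R : realType).
Implicit Types s t a b p q : R.

Lemma spow_norm t s : s != 0 -> `|spow t s| = `|t| `^ s.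
Proof.
move=> s0; rewrite /spow normrM [X in _ * X]ger0_norm ?powR_ge0// normr_sg.
by have [->|t0] := eqVneq t 0; rewrite ?mul1r// normr0 powR0 ?mulr0.
Qed.

Lemma spow_ge0 t s : 0 <= t -> s != 0 -> spow t s = t `^ s.
Proof.
rewrite le_eqVlt => /predU1P[<-|t0] s0; first by rewrite /spow sgr0 mul0r powR0.
by rewrite /spow gtr0_sg// mul1r gtr0_norm.
Qed.

Lemma spowN t s : spow (- t) s = - spow t s.
Proof. by rewrite /spow sgrN normrN mulNr. Qed.

Lemma spowM a b s : spow (a * b) s = spow a s * spow b s.
Proof. by rewrite /spow sgrM normrM powRM// mulrACA. Qed.

Lemma spow_sg t s : s != 0 -> Num.sg (spow t s) = Num.sg t.
Proof.
move=> s0; rewrite /spow sgrM sgr_id.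
have [->|t0] := eqVneq t 0; first by rewrite sgr0 mul0r.
by rewrite [X in _ * X]gtr0_sg ?mulr1// powR_gt0 ?normr_gt0.
Qed.

Lemma spowKV t s : s != 0 -> spow (spow t s) s^-1 = t.
Proof.
move=> s0; rewrite {1}/spow spow_sg// spow_norm// -powRrM mulfV// powRr1//.
by rewrite -numEsg.
Qed.

Lemma spowVK t s : s != 0 -> spow (spow t s^-1) s = t.
Proof. by move=> s0; have := @spowKV t s^-1; rewrite invrK invr_eq0; exact. Qed.

Lemma spow_continuous s : 0 < s -> continuous (fun t => spow t s).
Proof.
move=> s0 t; have [->|t0] := eqVneq t 0.
  rewrite /prop_for/continuous_at {2}/spow sgr0 mul0r.
  apply/cvgrPdist_lt => e e0; apply/nbhs_ballP.
  exists (e `^ s^-1); first exact: powR_gt0.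
  move=> v; rewrite /ball /= !sub0r !normrN spow_norm ?gt_eqF// => ve.
  have := gt0_ltr_powR s0 (normr_ge0 v) (powR_ge0 e s^-1) ve.
  by rewrite -powRrM mulVf ?gt_eqF// powRr1 ?ltW.
(* This form treats both signs at once, and holds at [v = 0] too since both sides vanish. *)
have spowE v : spow v s = v * expR ((s - 1) * ln `|v|).
  rewrite /spow; have [->|v0] := eqVneq v 0; first by rewrite sgr0 !mul0r.
  by rewrite -mulr_powRB1// mulrA -numEsg /powR normr_eq0 (negbTE v0).
rewrite (_ : (fun v => spow v s) = fun v => v * expR ((s - 1) * ln `|v|)); last exact/funext.
apply: cvgM; first exact: cvg_id.
apply: (@continuous_comp _ _ _ (fun v => (s - 1) * ln `|v|) expR); last exact: continuous_expR.
apply: cvgMr; apply: (@continuous_comp _ _ _ (fun v : R => `|v|) (@ln R)).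
  exact: norm_continuous.
by apply: continuous_ln; rewrite normr_gt0.
Qed.

(** A linear combination formed on signed [p]-th roots. Addition in the convexification has
    [a = b = 1], [lq_fun q] is the case of exponent [q^-1] on absolute values, and coefficients
    [1/2] and [-1/2] serve in the converse implication. *)
Definition pmean p a b (u : R * R) := spow (a * spow u.1 p^-1 + b * spow u.2 p^-1) p.

Lemma pmean_H2 p a b : 0 < p -> H2 (pmean p a b).
Proof.
move=> p0; have pn0 : p != 0 by rewrite gt_eqF.
split=> [u|c u c0].
  apply: (@continuous_comp _ _ _ (fun u => a * spow u.1 p^-1 + b * spow u.2 p^-1)
    (fun t => spow t p)).
    apply: cvgD; apply: cvgMr.
      apply: (@continuous_comp _ _ _ fst (fun t => spow t p^-1)); first exact: cvg_fst.
      by apply: spow_continuous; rewrite invr_gt0.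
    apply: (@continuous_comp _ _ _ snd (fun t => spow t p^-1)); first exact: cvg_snd.
    by apply: spow_continuous; rewrite invr_gt0.
  exact: spow_continuous.
rewrite /pmean /= !spowM.
rewrite (_ : _ + _ = spow c p^-1 * (a * spow u.1 p^-1 + b * spow u.2 p^-1)); last by ring.
by rewrite spowM spowVK.
Qed.

Lemma conv_funE p : conv_fun p = pmean p 1 1 :> (R * R -> R).
Proof. by apply/funext => u; rewrite /conv_fun /pmean !mul1r. Qed.

Lemma conv_fun_H2 p : 0 < p -> H2 (@conv_fun R p).
Proof. by rewrite conv_funE; exact: pmean_H2. Qed.

Lemma lq_fun_H2 q : 0 < q -> H2 (@lq_fun R q).
Proof.
move=> q0; have qV : q^-1 != 0 by rewrite invr_eq0 gt_eqF.
have -> : @lq_fun R q = fun u => pmean q^-1 1 1 (`|u.1|, `|u.2|).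
  apply/funext => u; rewrite /lq_fun /pmean /= !mul1r invrK.
  by rewrite ![spow `|_| q]spow_ge0 ?gt_eqF// spow_ge0 ?addr_ge0 ?powR_ge0.
apply: H2_comp; first by apply: pmean_H2; rewrite invr_gt0.
  by apply: H2_norm; exact: H2_fst.
by apply: H2_norm; exact: H2_snd.
Qed.

Lemma lq_fun_le q a b : 1 <= q -> 0 <= a -> 0 <= b -> lq_fun q (a, b) <= a + b.
Proof.
move=> q1 a0 b0; have q0 : 0 < q := lt_le_trans ltr01 q1.
have ab0 : 0 <= a + b by rewrite addr_ge0.
have -> : a + b = ((a + b) `^ q) `^ q^-1 by rewrite -powRrM mulfV ?gt_eqF// powRr1.
rewrite /lq_fun /= !ger0_norm//.
apply: ge0_ler_powR; rewrite ?nnegrE ?invr_ge0 ?addr_ge0 ?powR_ge0 ?(ltW q0)//.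
(* Applied to [c = a] and [c = b] and summed, this bounds [a^q + b^q] by [(a + b)^q]. *)
have sub c : 0 <= c -> c <= a + b -> c `^ q <= c * (a + b) `^ (q - 1).
  move=> c0 cab; rewrite -(mulr_powRB1 c0 q0) ler_wpM2l//.
  by apply: ge0_ler_powR; rewrite ?nnegrE// subr_ge0.
apply: (@le_trans _ _ ((a + b) * (a + b) `^ (q - 1))); last by rewrite mulr_powRB1.
by rewrite mulrDl lerD// sub// ?lerDl ?lerDr.
Qed.

Lemma powR_bernoulli p t : 1 < p -> t != 1 -> 1 + p * (t - 1) < `|t| `^ p.
Proof.
move=> p1 t1; have p0 : 0 < p := lt_trans ltr01 p1.
have [t0|t0] := leP t 0.
  apply: lt_le_trans (powR_ge0 _ _); apply: (@le_lt_trans _ _ (1 - p)); last by lra.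
  by have := mulr_ge0_le0 (ltW p0) t0; lra.
rewrite gtr0_norm// /powR gt_eqF//; set l := ln t.
have l0 : l != 0 by rewrite ln_eq0.
have tl : t = expR l by rewrite lnK.
(* the tangent to [expR] at [l], evaluated at [p * l] and at [0] *)
have tangent1 : expR l * (1 + (p * l - l)) < expR (p * l).
  rewrite -[X in _ < expR X](subrKC l) expRD ltr_pM2l ?expR_gt0//.
  by apply: expR_gt1Dx; rewrite -[X in _ - X]mul1r -mulrBl mulf_neq0// subr_eq0 gt_eqF.
have tangent2 : expR l * (1 - l) < 1.
  rewrite -[ltRHS](expR0 R) -[X in _ < expR X](subrr l) expRD ltr_pM2l ?expR_gt0//.
  by apply: expR_gt1Dx; rewrite oppr_eq0.
(* With weight [p - 1] the terms in [l] cancel against the first tangent, leaving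
   [p * t < t^p + p - 1]. *)
have : (p - 1) * (expR l * (1 - l)) < (p - 1) * 1 by rewrite ltr_pM2l ?subr_gt0.
by rewrite tl; lra.
Qed.

(** Strict midpoint convexity. For nonzero [a], divide by it and add Bernoulli's inequality at
    [1 + b / a] and [1 - b / a]: the linear terms cancel. *)
Lemma powR_midpoint_lt p a b : 1 < p -> b != 0 ->
  2 * `|a| `^ p < `|a + b| `^ p + `|a - b| `^ p.
Proof.
move=> p1 b0; have p0 : 0 < p := lt_trans ltr01 p1.
have [->|a0] := eqVneq a 0.
  by rewrite normr0 powR0 ?gt_eqF// mulr0 addr_gt0// powR_gt0// normr_gt0 ?add0r ?sub0r ?oppr_eq0.
have scale c : `|a * c| `^ p = `|a| `^ p * `|c| `^ p by rewrite normrM powRM.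
have -> : a + b = a * (1 + b / a) by field.
have -> : a - b = a * (1 - b / a) by field.
rewrite !scale -mulrDr mulrC ltr_pM2l ?powR_gt0 ?normr_gt0//.
have ba : b / a != 0 by rewrite mulf_neq0// invr_eq0.
have h1 : 1 + p * ((1 + b / a) - 1) < `|1 + b / a| `^ p.
  by apply: powR_bernoulli => //; rewrite -subr_eq0 addrAC subrr add0r.
have h2 : 1 + p * ((1 - b / a) - 1) < `|1 - b / a| `^ p.
  by apply: powR_bernoulli => //; rewrite -subr_eq0 addrAC subrr add0r oppr_eq0.
lra.
Qed.

Lemma conv_fun_norm p u : 1 < p -> `|conv_fun p u| = `|spow u.1 p^-1 + spow u.2 p^-1| `^ p.
Proof. by move=> p1; rewrite spow_norm// gt_eqF// (lt_trans ltr01). Qed.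

(** Midpoint convexity for the signed roots of the coordinates. The equality case is the vanishing
    condition that [snd_dominated] puts on the gap. *)
Lemma conv_fun_midpoint p u : 1 < p ->
  `|u.1| <= 2^-1 * (`|conv_fun p u| + `|conv_fun p (u.1, - u.2)|) ?= iff (u.2 == 0).
Proof.
move=> p1; have p0 : 0 < p := lt_trans ltr01 p1; have pn0 : p != 0 by rewrite gt_eqF.
have pV : p^-1 != 0 by rewrite invr_eq0.
rewrite !conv_fun_norm//= spowN; have u1 : `|spow u.1 p^-1| `^ p = `|u.1|.
  by rewrite spow_norm// -powRrM mulVf// powRr1.
have [u2|u2] := eqVneq u.2 0.
  rewrite u2 /spow sgr0 mul0r subr0 addr0 -/(spow _ _) u1.
  have -> : 2^-1 * (`|u.1| + `|u.1|) = `|u.1| by lra.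
  exact/leif_refl.
have b0 : spow u.2 p^-1 != 0 by rewrite -sgr_eq0 spow_sg// sgr_eq0.
have := powR_midpoint_lt (spow u.1 p^-1) p1 b0; rewrite u1 => lt.
have {}lt : `|u.1| < 2^-1 * (`|spow u.1 p^-1 + spow u.2 p^-1| `^ p +
    `|spow u.1 p^-1 - spow u.2 p^-1| `^ p) by lra.
by split; [exact: ltW | exact: lt_eqF].
Qed.

Lemma snd_dominated (G : R * R -> R) (c : R) : H2 G -> (forall u, 0 <= G u) ->
  (forall u, u.2 != 0 -> 0 < G u) -> 0 < c ->
  exists2 C, 0 < C & forall u, `|u.2| <= c * `|u.1| + C * G u.
Proof.
move=> hG G0 Gpos c0.
(* The extra term lives on the cone [|u.2| < c * |u.1|] and makes [K] positive also where [u.2 = 0],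
   so [K] has a positive minimum on the sphere; off the cone [K] is [G]. *)
pose K u := G u + Num.max 0 (c * `|u.1| - `|u.2|).
have h1 : H2 (fun u : R * R => `|u.1|) by apply: H2_norm; exact: H2_fst.
have h2 : H2 (fun u : R * R => `|u.2|) by apply: H2_norm; exact: H2_snd.
have hz : H2 (fun _ : R * R => 0 : R) by split=> [u|a u _]; [exact: cvg_cst|rewrite mulr0].
have hK : H2 K.
  apply: H2_add => //; apply: H2_max => //.
  by apply: H2_add; [exact: H2_scale | exact: H2_opp].
have [||m m1 Km] := compact_EVT_min (f := K) _ (@compact_unit_sphere R).
- by exists (1, 1); rewrite /= prod_normE/= normr1 maxxx.
- by apply: continuous_subspaceT; case: hK.
have Km0 : 0 < K m.
  have [m2|m2] := eqVneq m.2 0; last by rewrite ltr_wpDr ?Gpos// le_max lexx.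
  move: m1; rewrite inE /= prod_normE /= m2 normr0 max_l// => m1.
  by rewrite ltr_wpDl// lt_max m1 m2 normr0 mulr1 subr0 c0 orbT.
have bound : forall u, K m * `|u| <= K u.
  apply: H2_bound => //; last by move=> u u1; rewrite u1 mulr1 Km// inE.
  exact: H2_scale (H2_max h1 h2).
exists (K m)^-1 => [|u]; first by rewrite invr_gt0.
have [le|lt] := leP `|u.2| (c * `|u.1|); first by rewrite ler_wpDr// mulr_ge0// invr_ge0 ltW.
apply: (@le_trans _ _ ((K m)^-1 * G u)); last by rewrite ler_wpDl// mulr_ge0// ltW.
rewrite ler_pdivlMl//; have := bound u; rewrite {2}/K max_l; last by rewrite subr_le0 ltW.
rewrite addr0; apply: le_trans; rewrite ler_wpM2l ?(ltW Km0)// prod_normE/=.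
by rewrite le_max lexx orbT.
Qed.

End SignedPower.

(** The infimum defining [Mq] is [+oo] over an empty set, so a real lower bound has to be
    extracted. *)
Lemma ereal_gt0_bound (R : realType) (a : \bar R) : (0 < a)%E ->
  exists2 r : R, 0 < r & (r%:E <= a)%E.
Proof.
case: a => [r r0||//]; first by exists r.
by exists 1; rewrite ?ltr01// leey.
Qed.

(** * Uniform monotonicity against uniform convexity of the convexification *)

Section Convexification.
Context (R : realType) (E : completeNormedModType R) (L : lattice_on E).
Hypothesis hL : is_banach_lattice L.
Implicit Types (G : R * R -> R) (x y : E).

Lemma H2_fstN : H2 (fun u : R * R => `|u.1|).
Proof. by apply: H2_norm; exact: H2_fst. Qed.

Lemma norm_krivine_fstN x y : `|krivine L (fun u => `|u.1|) x y| = `|x|.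
Proof. by rewrite krivine_labs; [rewrite norm_labs// krivine_fst|exact: hL|exact: H2_fst]. Qed.

Lemma norm_snd_dominated x y G (c C : R) : H2 G -> 0 <= c -> 0 <= C ->
  (forall u, `|u.2| <= c * `|u.1| + C * G u) ->
  `|y| <= c * `|x| + C * `|krivine L G x y|.
Proof.
move=> hG c0 C0 dom; have h1 := H2_scale c H2_fstN; have h2 := H2_scale C hG.
rewrite -[X in `|X| <= _](krivine_snd hL x y).
apply: (@le_trans _ _ `|krivine L (fun u => c * `|u.1| + C * G u) x y|).
  apply: krivine_norm_le => //; [exact: H2_snd|exact: H2_add|].
  by move=> u; apply: le_trans (dom u) (ler_norm _).
rewrite krivineD// !krivineZ//; last exact: H2_fstN.
apply: le_trans (ler_normD _ _) _.
by rewrite !normrZ norm_krivine_fstN !ger0_norm.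
Qed.

Lemma norm_krivine_mean x y F G : H2 F -> H2 G ->
  `|krivine L (fun u => 2^-1 * (`|F u| + `|G u|)) x y| <=
  Num.max `|krivine L F x y| `|krivine L G x y|.
Proof.
move=> hF hG.
rewrite krivineZ; [|exact: hL|by apply: H2_add; exact: H2_norm].
rewrite krivineD; [|exact: hL|exact: H2_norm|exact: H2_norm].
rewrite !krivine_labs// normrZ ger0_norm// ler_pdivrMl//.
apply: le_trans (ler_normD _ _) _; rewrite !norm_labs//.
by rewrite mulrDl mul1r lerD// le_max lexx ?orbT.
Qed.

Lemma psmulN1 (p : R) y : psmul p (-1) y = - y.
Proof. by rewrite /psmul /spow sgrN1 normrN1 powR1 mulr1 scaleN1r. Qed.

Lemma paddE (p : R) F G x y : 0 < p -> H2 F -> H2 G ->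
  padd L p (krivine L F x y) (krivine L G x y) = krivine L (fun u => conv_fun p (F u, G u)) x y.
Proof. by move=> p0 hF hG; rewrite /padd krivine_comp//; exact: conv_fun_H2. Qed.

Lemma padd_subE (p : R) F G x y : 0 < p -> H2 F -> H2 G ->
  padd L p (krivine L F x y) (psmul p (-1) (krivine L G x y)) =
  krivine L (fun u => conv_fun p (F u, - G u)) x y.
Proof.
move=> p0 hF hG; have hG' := H2_opp hG; rewrite psmulN1.
have -> : - krivine L G x y = krivine L (fun u => - G u) x y.
  rewrite -scaleN1r -(krivineZ hL x y (-1) hG); congr (krivine L _ x y).
  by apply/funext => u; rewrite mulN1r.
exact: paddE p0 hF hG'.
Qed.

Lemma uniformly_monotone_convex (p : R) : uniformly_monotone L -> 1 < p ->
  pconv_uniformly_convex L p.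
Proof.
move=> [q [q1 mono]] p1 eps eps0.
have p0 : 0 < p := lt_trans ltr01 p1; have pn0 : p != 0 by rewrite gt_eqF.
have q0 : 0 < q := lt_le_trans ltr01 q1.
have hc : H2 (@conv_fun R p) := conv_fun_H2 p0.
have hc' : H2 (fun u : R * R => conv_fun p (u.1, - u.2)).
  by apply: H2_comp => //; [exact: H2_fst|apply: H2_opp; exact: H2_snd].
pose m (u : R * R) := 2^-1 * (`|conv_fun p u| + `|conv_fun p (u.1, - u.2)|).
have hm : H2 m := H2_scale _ (H2_add (H2_norm hc) (H2_norm hc')).
pose G u := m u - `|u.1|.
have hG : H2 G := H2_add hm (H2_opp H2_fstN).
have G0 u : 0 <= G u by rewrite subr_ge0; exact: leif_le (conv_fun_midpoint u p1).
have Gpos u : u.2 != 0 -> 0 < G u.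
  by move=> u2; rewrite subr_gt0 (lt_leif (conv_fun_midpoint u p1)).
(* The norm of the convexification is a [p]-th root, so the bound [eps] on it reads [eps^p] in
   [E]. *)
pose e := eps `^ p; have e0 : 0 < e by rewrite powR_gt0.
(* With [c = e / 2] and [|x| = 1] half of [|y| >= e] is absorbed, so [C] times the norm of [G(x, y)]
   is at least [e / 2]. *)
have [C C0 dom] := snd_dominated hG G0 Gpos (divr_gt0 e0 (ltr0Sn R 1)).
have [mu mu0 muM] := ereal_gt0_bound (mono (e / 2 / C) (divr_gt0 (divr_gt0 e0 (ltr0Sn R 1)) C0)).
have mu1 : 1 < 1 + mu by rewrite ltrDl.
(* The bound [1 + mu] in [E] becomes its [p]-th root in the convexification. *)
exists ((1 + mu) `^ p^-1 - 1).
  have e1 : (1 : R) `^ p^-1 = 1 by rewrite powR1.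
  rewrite subr_gt0 -[ltLHS]e1.
  by apply: gt0_ltr_powR; rewrite ?invr_gt0 ?nnegrE ?ltr01// ltW// (lt_trans ltr01).
rewrite addrC subrK; apply: le_ereal_inf_tmp => _ [x [y [ye x1 ->]]].
have {}x1 : `|x| = 1.
  have : (`|x| `^ p^-1) `^ p = 1 by rewrite -/(pnorm p x) x1 powR1.
  by rewrite -powRrM mulVf// powRr1.
have {}ye : e <= `|y|.
  have : eps `^ p <= (`|y| `^ p^-1) `^ p.
    by apply: ge0_ler_powR; rewrite ?nnegrE ?powR_ge0 ?(ltW p0) ?(ltW eps0).
  by rewrite -powRrM mulVf// powRr1.
set w := krivine L G x y.
have wlarge : e / 2 / C <= `|w|.
  have e2 : 0 <= e / 2 by rewrite divr_ge0// ltW.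
  have := norm_snd_dominated x y hG e2 (ltW C0) dom.
  by rewrite x1 ler_pdivrMr// -/w [_ * C]mulrC; lra.
have : mu <= `|krivine L (lq_fun q) x w| - 1.
  rewrite -lee_fin; apply: le_trans muM _; apply: ereal_inf_lbound.
  by exists x, w.
(* Pointwise, [lq_fun q (u.1, G u) <= |u.1| + G u], and the right side is [m u] by the choice of
   [G]. *)
have : `|krivine L (lq_fun q) x w| <= `|krivine L m x y|.
  rewrite -[X in krivine L _ X w](krivine_fst hL x y) krivine_comp//; first last.
  - exact: H2_fst.
  - exact: lq_fun_H2.
  apply: krivine_norm_le => //.
    by apply: H2_comp => //; [exact: lq_fun_H2|exact: H2_fst].
  move=> u; rewrite ger0_norm ?powR_ge0//; apply: le_trans (ler_norm _).
  have -> : lq_fun q (u.1, G u) = lq_fun q (`|u.1|, G u) by rewrite /lq_fun /= normr_id.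
  by apply: le_trans (lq_fun_le _ _ _) _ => //; rewrite /G subrKC.
have : `|krivine L m x y| <= Num.max `|padd L p x y| `|padd L p x (psmul p (-1) y)|.
  have -> : padd L p x (psmul p (-1) y) = krivine L (fun u => conv_fun p (u.1, - u.2)) x y.
    have := padd_subE x y p0 (@H2_fst R) (@H2_snd R).
    by rewrite (krivine_fst hL) (krivine_snd hL).
  exact: norm_krivine_mean hc hc'.
set N1 := `|padd L p x y|; set N2 := `|padd L p x (psmul p (-1) y)| => h1 h2 h3.
have h4 : 1 + mu <= Num.max N1 N2.
  by apply: le_trans (le_trans h2 h1); rewrite addrC -lerBrDr.
have pV : 0 <= p^-1 by rewrite invr_ge0 ltW.
have mup : 0 <= 1 + mu by rewrite addr_ge0// ltW.
rewrite lee_fin /pnorm -/N1 -/N2 le_max; apply/orP.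
by move: h4; rewrite le_max => /orP[h|h]; [left|right];
  apply: ge0_ler_powR => //; rewrite nnegrE normr_ge0.
Qed.

Lemma convex_uniformly_monotone (p : R) : 1 < p ->
  pconv_uniformly_convex L p -> uniformly_monotone L.
Proof.
move=> p1 conv; exists 1; split=> // eps eps0.
have p0 : 0 < p := lt_trans ltr01 p1; have pn0 : p != 0 by rewrite gt_eqF.
have pVn0 : p^-1 != 0 by rewrite invr_eq0.
have ler_spow (a b : R) s : 0 < s -> 0 <= a -> a <= b -> spow a s <= spow b s.
  move=> s0 a0 ab; rewrite !spow_ge0 ?gt_eqF ?(le_trans a0)//.
  by apply: ge0_ler_powR; rewrite ?nnegrE ?(ltW s0) ?(le_trans a0).
have spow_nn (a : R) s : 0 <= a -> s != 0 -> 0 <= spow a s.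
  by move=> a0 s0; rewrite spow_ge0// powR_ge0.
pose S (u : R * R) := `|u.1| + `|u.2|.
have hS : H2 S by apply: H2_add; [exact: H2_fstN|apply: H2_norm; exact: H2_snd].
have S1 u : `|u.1| <= S u by rewrite lerDl.
have S0 u : 0 <= S u by rewrite addr_ge0.
(* Half sum and half difference of the [p]-th roots of [S u] and [|u.1|]: the solution of
   [conv_fun p (M, D) = S] and [conv_fun p (M, - D) = |u.1|]. *)
pose M u := pmean p 2^-1 2^-1 (S u, `|u.1|).
pose D u := pmean p 2^-1 (- 2^-1) (S u, `|u.1|).
have hM : H2 M := H2_comp (pmean_H2 2^-1 2^-1 p0) hS H2_fstN.
have hD : H2 D := H2_comp (pmean_H2 2^-1 (- 2^-1) p0) hS H2_fstN.
have MD u : conv_fun p (M u, D u) = S u.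
  rewrite /conv_fun /M /D /pmean /= !spowKV//.
  rewrite (_ : _ + _ = spow (S u) p^-1); last by lra.
  by rewrite spowVK.
have MND u : conv_fun p (M u, - D u) = `|u.1|.
  rewrite /conv_fun /M /D /pmean /= spowN !spowKV//.
  rewrite (_ : _ - _ = spow `|u.1| p^-1); last by lra.
  by rewrite spowVK.
have pV0 : 0 < p^-1 by rewrite invr_gt0.
have root u := ler_spow _ _ _ pV0 (normr_ge0 u.1) (S1 u).
have root0 (u : R * R) : 0 <= spow `|u.1| p^-1 by rewrite spow_nn.
have M1 u : `|u.1| <= M u.
  rewrite -[leLHS](spowVK _ pn0); apply: ler_spow => //=.
  by have := root u; lra.
have MS u : M u <= S u.
  rewrite -[leRHS](spowVK _ pn0); apply: ler_spow => //=; have := root u; have := root0 u; lra.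
have M0 u : 0 <= M u by apply: le_trans (M1 u).
have D0 u : 0 <= D u by rewrite spow_nn//=; have := root u; lra.
have Dpos u : u.2 != 0 -> 0 < D u.
  move=> u2; rewrite lt_neqAle D0 andbT eq_sym; apply/eqP => Du0.
  (* When [D u = 0] the two identities have the same left side, so [S u = |u.1|] and [u.2 = 0]. *)
  have := MD u; have := MND u; rewrite Du0 oppr0 => -> /eqP.
  by rewrite -subr_eq0 opprD addNKr oppr_eq0 normr_eq0 (negbTE u2).
clearbody M D.
have [C C0 dom] := snd_dominated hD D0 Dpos (divr_gt0 eps0 (ltr0Sn R 1)).
(* Chosen so that [d / s < eta] gives [eps < eps / 2 + eps / 4 * N], which forces [N > 2]. *)
pose eta := eps / 4 / C; have eta0 : 0 < eta by rewrite !divr_gt0.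
have [delta delta0 uc] := conv (eta `^ p^-1) (powR_gt0 _ eta0).
(* The bound [delta] comes from uniform convexity when [d / s] is at least [eta], the bound 1 from
   [N > 2] otherwise. *)
apply: (@lt_le_trans _ _ (Num.min delta 1)%:E); first by rewrite lte_fin lt_min delta0 ltr01.
apply: le_ereal_inf_tmp => _ [x [y [ye x1 ->]]]; rewrite lee_fin.
have -> : @lq_fun R 1 = S.
  by apply/funext => u; rewrite /lq_fun invr1 !powRr1// addr_ge0.
set N := `|krivine L S x y|; set s := `|krivine L M x y|; set d := `|krivine L D x y|.
have s1 : 1 <= s.
  rewrite -x1 -(norm_krivine_fstN x y); apply: krivine_norm_le => //; first exact: H2_fstN.
  by move=> u; rewrite normr_id (ger0_norm (M0 u)).
have sN : s <= N by apply: krivine_norm_le => // u; rewrite !ger0_norm.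
have s0 : 0 < s := lt_le_trans ltr01 s1.
have yd : `|y| <= eps / 2 * `|x| + C * d.
  by apply: norm_snd_dominated => //; rewrite ltW// divr_gt0.
have [large|small] := leP eta (d / s); last first.
  have : C * d < eps / 4 * N.
    move: small; rewrite ltr_pdivrMr// => small.
    apply: (@lt_le_trans _ _ (C * (eta * s))); first by rewrite ltr_pM2l.
    by rewrite mulrA [C * eta]mulrC /eta divfK ?gt_eqF// ler_wpM2l// divr_ge0// ltW.
  move=> CdN; have : 2 < N.
    have : eps * 2 < eps * N by move: yd; rewrite x1; lra.
    by rewrite ltr_pM2l.
  by move=> N2; rewrite ge_min; apply/orP; right; lra.
have hMs : H2 (fun u => s^-1 * M u) := H2_scale _ hM.
have hDs : H2 (fun u => s^-1 * D u) := H2_scale _ hD.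
have sV0 : 0 <= s^-1 by rewrite invr_ge0 ltW.
(* Dividing by [s] gives [M] norm 1, and by homogeneity the sum and difference in the
   convexification become [S] and [|u.1|] divided by [s]. *)
have : (1 + delta <= Num.max (pnorm p (s^-1 *: krivine L S x y))
    (pnorm p (s^-1 *: krivine L (fun u => `|u.1|) x y))).
  rewrite -lee_fin; apply: le_trans uc _; apply: ereal_inf_lbound.
  exists (s^-1 *: krivine L M x y), (s^-1 *: krivine L D x y); split.
  - rewrite /pnorm normrZ ger0_norm// [_^-1 * _]mulrC.
    apply: ge0_ler_powR; rewrite ?nnegrE ?(ltW eta0) ?(ltW pV0)//.
    by rewrite divr_ge0 ?(ltW s0)// normr_ge0.
  - by rewrite /pnorm normrZ ger0_norm// mulVf ?gt_eqF// powR1.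
  have [_ hom] := @conv_fun_H2 R p p0.
  have -> : padd L p (s^-1 *: krivine L M x y) (s^-1 *: krivine L D x y) = s^-1 *: krivine L S x y.
    rewrite -!(krivineZ hL)// (paddE x y p0 hMs hDs); congr (krivine L _ x y).
    by apply/funext => u; rewrite (hom _ (M u, D u))// MD.
  have -> // : padd L p (s^-1 *: krivine L M x y) (psmul p (-1) (s^-1 *: krivine L D x y)) =
      s^-1 *: krivine L (fun u => `|u.1|) x y.
  rewrite -(krivineZ hL x y _ hM) -(krivineZ hL x y _ hD) -(krivineZ hL x y _ H2_fstN).
  rewrite (padd_subE x y p0 hMs hDs); congr (krivine L _ x y).
  by apply/funext => u; rewrite -mulrN (hom _ (M u, - D u))// MND.
have pV1 : p^-1 <= 1 by rewrite invf_le1// ltW.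
have N1 : 1 <= N := le_trans s1 sN.
(* Since [s >= 1] and [N >= 1], neither the division nor the [p]-th root leads above [N]; this
   covers both terms of the maximum, the second because [|x| = 1 <= N]. *)
have pnorm_le z : `|z| <= N -> pnorm p (s^-1 *: z) <= N.
  move=> zN; apply: le_trans (ler1_powR N1 pV1).
  apply: ge0_ler_powR; rewrite ?nnegrE ?(ltW pV0) ?normr_ge0 ?(le_trans ler01)//.
  rewrite normrZ ger0_norm//; apply: le_trans zN.
  by rewrite ler_piMl// invf_le1.
move=> le_max_; have : 1 + delta <= N.
  apply: le_trans le_max_ _; rewrite ge_max !pnorm_le// norm_krivine_fstN x1//.
by move=> dN; rewrite ge_min; apply/orP; left; lra.
Qed.

End Convexification.

Theorem theorem3p2 (R : realType) (E : completeNormedModType R)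
    (L : lattice_on E) (hL : is_banach_lattice L) :
  (uniformly_monotone L <->
     (forall p : R, 1 < p -> pconv_uniformly_convex L p)) /\
  ((forall p : R, 1 < p -> pconv_uniformly_convex L p) <->
     (exists2 p : R, 1 < p & pconv_uniformly_convex L p)).
Proof.
have two : (1 : R) < 2 by rewrite ltr1n.
split; split.
- by move=> mono p p1; exact: uniformly_monotone_convex.
- by move=> /(_ 2 two); exact: convex_uniformly_monotone.
- by move=> all; exists 2 => //; exact: all.
- move=> [p p1 /(convex_uniformly_monotone hL p1) mono] r r1.
  exact: uniformly_monotone_convex.
Qed.
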